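(* Let $d\ge 1$ and let $h$ be a Gaussian mixture density on $\mathbb{R}^d$ that is a Morse function (all of its critical points are nondegenerate). If $N$ is the total number of critical points of $h$ and $M$ is the number of local maxima of $h$, then \[ M\le\left\lfloor\frac{N+1}{2}\right\rfloor. \]
   Context: A Gaussian mixture density on $\mathbb{R}^d$ is a function $h(x)=\sum_{i=1}^k\alpha_i\phi_i(x)$ for some integer $k\ge1$, where $\alpha_i>0$, $\sum_{i=1}^k\alpha_i=1$, and $\phi_i(x)=(2\pi)^{-d/2}\det(\Sigma_i)^{-1/2}\exp\left(-\frac12(x-\mu_i)^\top\Sigma_i^{-1}(x-\mu_i)\right)$ with $\mu_i\in\mathbb{R}^d$ and each $\Sigma_i$ a (symmetric) positive definite $d\times d$ matrix. A critical point $x$ (i.e. $\nabla h(x)=0$) is nondegenerate if the Hessian $D^2h(x)$ is nonsingular. A local maximum is a point $x$ for which there is $r>0$ with $h(y)\le h(x)$ whenever $\|y-x\|<r$. *)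

(* Defs.v *)
From HB Require Import structures.
From mathcomp Require Import all_boot all_order all_algebra.
From mathcomp Require Import boolp classical_sets cardinality reals.
From mathcomp Require Import topology normedtype derive sequences exp trigo.

Set Implicit Arguments.
Unset Strict Implicit.
Unset Printing Implicit Defensive.

Import Order.TTheory GRing.Theory Num.Theory.
Import numFieldNormedType.Exports.

Local Open Scope classical_set_scope.
Local Open Scope ring_scope.

(* Points of R^d are row vectors 'rV[R]_d, so the column-vector expression
   v^T A v becomes v *m A *m v^T, a 1 x 1 matrix. *)

Definition quad_form (R : realType) (d : nat) (A : 'M[R]_d) (v : 'rV[R]_d) : R :=
  (v *m A *m v^T) 0 0.

Definition posdef (R : realType) (d : nat) (A : 'M[R]_d) : Prop :=
  A^T = A /\ forall v : 'rV[R]_d, v != 0 -> 0 < quad_form A v.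

Definition gaussian_pdf (R : realType) (d : nat)
    (mu : 'rV[R]_d) (Sigma : 'M[R]_d) (x : 'rV[R]_d) : R :=
  (2 * pi) `^ (- (d%:R / 2)) * (\det Sigma) `^ (- (1 / 2)) *
  expR (- (1 / 2) * quad_form (invmx Sigma) (x - mu)).

Definition gaussian_mixture (R : realType) (d : nat) (h : 'rV[R]_d -> R) : Prop :=
  exists (k : nat) (alpha : 'I_k -> R)
         (mu : 'I_k -> 'rV[R]_d) (Sigma : 'I_k -> 'M[R]_d),
    [/\ (1 <= k)%N,
        forall i, 0 < alpha i,
        \sum_(i < k) alpha i = 1,
        forall i, posdef (Sigma i)
      & forall x, h x = \sum_(i < k) alpha i * gaussian_pdf (mu i) (Sigma i) x].

Definition gradient (R : realType) (d : nat) (h : 'rV[R]_d -> R)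
    (x : 'rV[R]_d) : 'rV[R]_d :=
  \row_(i < d) ('D_('e_i) h x : R).

Definition hessian (R : realType) (d : nat) (h : 'rV[R]_d -> R)
    (x : 'rV[R]_d) : 'M[R]_d :=
  \matrix_(i < d, j < d) ('D_('e_i) ('D_('e_j) h) x : R).

Definition critical_points (R : realType) (d : nat) (h : 'rV[R]_d -> R) :
    set 'rV[R]_d :=
  [set x | gradient h x = 0].

(* For a critical point x.  No regularity of h is required here or in [morse]:
   the library's derivative is total, so both are meant for smooth h. *)
Definition nondegenerate (R : realType) (d : nat) (h : 'rV[R]_d -> R)
    (x : 'rV[R]_d) : Prop :=
  hessian h x \in unitmx.

Definition morse (R : realType) (d : nat) (h : 'rV[R]_d -> R) : Prop :=
  forall x, critical_points h x -> nondegenerate h x.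

(* The library's norm on matrices is the sup norm. *)
Definition euclidean_norm (R : realType) (d : nat) (v : 'rV[R]_d) : R :=
  Num.sqrt (\sum_(i < d) v 0 i ^+ 2).

Definition local_maxima (R : realType) (d : nat) (h : 'rV[R]_d -> R) :
    set 'rV[R]_d :=
  [set x | exists r : R, 0 < r /\
     forall y, euclidean_norm (y - x) < r -> h y <= h x].

(* Main.v *)
Require Import Defs.
From HB Require Import structures.
From mathcomp Require Import all_boot all_order all_algebra finmap.
From mathcomp Require Import boolp classical_sets functions cardinality reals.
From mathcomp Require Import topology normedtype derive sequences realfun.
From mathcomp Require Import exp trigo.
From mathcomp Require Import ring lra.

Set Implicit Arguments.
Unset Strict Implicit.
Unset Printing Implicit Defensive.

Import Order.TTheory GRing.Theory Num.Theory.
Import numFieldNormedType.Exports.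
Local Open Scope classical_set_scope.
Local Open Scope ring_scope.
Local Open Scope card_scope.

(** Every local maximum is critical, so the claim is that the M maxima are
accompanied by at least M - 1 other critical points.  This is the degree-zero
part of the Morse inequalities, and it is obtained here from mountain passes,
without gradient flows and without the Morse lemma.

Join two points at level c when a connected set contains both and stays above
some level c' > c ([linked]).  Take a critical point x that is not a maximum.
Its Hessian has a direction e with D^2h(x)(e, e) > 0: otherwise it would be
negative semidefinite, hence negative definite because it is nonsingular, and
x would be a maximum.  Near x the function h is convex along e, so from any
point y near x with h y > h x one can walk without descending along e or
along - e, according to the sign of the derivative of h at y; the walk ends
near x + s e or near x - s e.  So, at level h x, every point just above x is
linked to one of two points ([two_sided]), and these two points are linked to
maxima, because a component of a superlevel set contains a maximum.  Each
non-maximal critical point thus yields an edge between two maxima (possibly a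
loop).  At a regular point the same walk, in a direction of increase, leaves a
single class of points just above.

The graph so obtained on the maxima is connected, hence has at least M - 1
edges ([card_le_crossing_edges]).  Suppose that no edge crosses a partition
Q, Q' of the maxima.  Let c be the infimum of the levels at which no point of
Q is linked to a point of Q'; it is positive since h is positive on segments.
At level c the two sides are not linked either, and since no point of height c
sees both sides, the parts of the superlevel set that belong to Q and to Q'
are disjoint closed sets.  Disjoint neighbourhoods of these parts contain a
slightly lower superlevel set, which contradicts the choice of c
([unlinked_lower], [separation_level]).

For a Gaussian mixture, superlevel sets at positive levels are compact since h
tends to 0 at infinity, and critical points stay in a bounded set since the
derivative of h at x in the direction x is negative far away.  Nondegenerate
critical points are isolated, so there are finitely many of them. *)

(** * Counting edges of a connected graph *)

(** A set of n + 1 vertices with at least n edges inside can be enlarged along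
an edge that leaves it, until it contains all the vertices. *)
Lemma card_le_crossing_edges (T I : finType) (a b : I -> T) :
  (forall S : {pred T}, (exists x, x \in S) -> (exists x, x \notin S) ->
     exists i, (a i \in S) != (b i \in S)) ->
  (#|T| <= #|I|.+1)%N.
Proof.
move=> cross.
pose inner (S : {set T}) := [set i | (a i \in S) && (b i \in S)]%SET.
have grow n : (n < #|T|)%N ->
    exists2 S : {set T}, #|S| = n.+1 & (n <= #|inner S|)%N.
  elim: n => [|n IHn] ltnT.
    by have /card_gt0P[x _] := ltnT; exists [set x]%SET; rewrite ?cards1.
  have [S cardS innerS] := IHn (ltnW ltnT).
  have [] := cross (mem S).
  - by apply/card_gt0P; rewrite cardS.
  - case: (pickP (fun x => x \notin S)) => [x|inS]; first by exists x.
    move: ltnT; rewrite -cardS (eq_cardT (fun x => negbFE (inS x))) -cardT.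
    by rewrite ltnn.
  move=> i /= crossi.
  have [y yS ab_y] : exists2 y, y \notin S &
      (a i \in y |: S)%SET && (b i \in y |: S)%SET.
    case: (boolP (a i \in S)) crossi => [aS | aS].
      case: (boolP (b i \in S)) => // bS _; exists (b i) => //.
      by rewrite !inE aS eqxx orbT.
    case: (boolP (b i \in S)) => // bS _; exists (a i) => //.
    by rewrite !inE bS eqxx orbT.
  exists (y |: S)%SET; first by rewrite cardsU1 yS cardS.
  apply: (leq_ltn_trans innerS); apply: proper_card.
  apply/fintype.properP; split.
    apply/fintype.subsetP => j; rewrite !inE => /andP[-> ->].
    by rewrite !orbT.
  exists i; rewrite !inE; move: ab_y crossi; rewrite !inE // => _.
  by do 2!case: (_ \in S).
case: (posnP #|T|) => [-> // | T_gt0].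
have [|S _] := grow #|T|.-1; first by rewrite prednK.
by move=> /leq_trans/(_ (max_card _)); rewrite -ltnS prednK.
Qed.

(** * Linking points inside superlevel sets *)

Section SuperlevelLinks.
Context {R : realType} {V : normedModType R}.
Implicit Types (h : V -> R) (c : R) (x y z p u v : V).

Definition local_max h x := \forall y \near x, h y <= h x.

(** The level c' > c gives a margin: two points linked at level c are still
linked at all slightly higher levels, which lets linkedness be compared with
the infimum of a set of levels. *)
Definition linked h c x y := exists2 c', c < c' & exists C : set V,
  [/\ connected C, C x, C y & C `<=` [set z | c' <= h z]].

Lemma closed_superlevel h c : continuous h -> closed [set x | c <= h x].
Proof.
move=> ch; apply: (@preimage_closed _ _ h [set r | c <= r]);
  last exact: closed_ge.
by move=> x _; exact: ch.
Qed.

Lemma linked_sym h c x y : linked h c x y -> linked h c y x.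
Proof. by case=> c' cc' [C [? ? ? ?]]; exists c' => //; exists C. Qed.

Lemma linked_trans h c x y z :
  linked h c x y -> linked h c y z -> linked h c x z.
Proof.
case=> c1 cc1 [C1 [C1c C1x C1y C1h]] [c2 cc2 [C2 [C2c C2y C2z C2h]]].
exists (Num.min c1 c2); first by rewrite lt_min cc1.
exists (C1 `|` C2); split; [|by left|by right|].
- by apply: connectedU => //; exists y.
- by move=> w [/C1h|/C2h] /=; rewrite ge_min => ->; rewrite ?orbT.
Qed.

Lemma linked_gtl h c x y : linked h c x y -> c < h x.
Proof. by case=> c' cc' [C [_ Cx _ /(_ _ Cx)]]; exact: lt_le_trans. Qed.

Lemma linked_refl h c x : c < h x -> linked h c x x.
Proof.
move=> ch; exists (h x) => //; exists [set x]; split => //.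
  exact: connected1.
by move=> _ -> /=.
Qed.

Lemma linked_segment h c c' x v : c < c' ->
  (forall t, 0 <= t <= 1 -> c' <= h (x + t *: v)) -> linked h c x (x + v).
Proof.
move=> cc' seg; exists c' => //.
exists ((fun t : R => x + t *: v) @` `[0, 1]); split.
- apply: connected_continuous_connected; first exact: segment_connected.
  apply: continuous_subspaceT => t.
  by apply: cvgD; [exact: cvg_cst | apply: cvgZr_tmp; exact: cvg_id].
- by exists 0; rewrite ?scale0r ?addr0//= in_itv /= lexx ler01.
- by exists 1; rewrite ?scale1r//= in_itv /= lexx ler01.
- by move=> _ [t /= + <-]; rewrite in_itv /=; exact: seg.
Qed.

Lemma linked_near h c x : {for x, continuous h} -> c < h x ->
  \forall y \near x, linked h c x y.
Proof.
move=> ch chx; have : \forall y \near x, (c + h x) / 2 <= h y.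
  have /cvgr_ge := ch; apply; lra.
move=> /nbhs_ballP[r r0 Br]; apply/nbhs_ballP; exists r => // y.
rewrite -ball_normE /= => xyr.
rewrite -[y](addrNK x) addrC.
apply: (@linked_segment _ _ ((c + h x) / 2)); first lra.
move=> t /andP[t0 t1]; apply: Br; rewrite -ball_normE /=.
rewrite opprD addNKr normrN normrZ ger0_norm// distrC.
by apply: le_lt_trans xyr; rewrite ler_piMl.
Qed.

(** The maximum of h over the closure of the class of x is attained above level
c, so near that point everything still belongs to the class. *)
Lemma linked_local_max h c x : continuous h -> compact [set z | c <= h z] ->
  c < h x -> exists2 p, local_max h p & linked h c x p.
Proof.
move=> ch Kc chx; pose C := [set z | linked h c x z].
have Ch : C `<=` [set z | c <= h z].
  by move=> z /linked_sym/linked_gtl/ltW.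
have Kcl : closed [set z | c <= h z] by exact: closed_superlevel.
have clCK : compact (closure C).
  apply: subclosed_compact Kc _; first exact: closed_closure.
  by rewrite closureE; exact: smallest_sub.
have clx : closure C x by apply: subset_closure; exact: linked_refl.
have [|p] := @compact_EVT_max _ _ h _ _ clCK (continuous_subspaceT ch).
  by exists x.
rewrite inE => clp pmax.
have chp : c < h p by apply: lt_le_trans chx (pmax _ _); rewrite inE.
have pnear := @linked_near _ _ p (ch p) chp.
have xp : linked h c x p.
  by have [z [xz pz]] := clp _ pnear; apply: linked_trans xz (linked_sym pz).
exists p => //; apply: filterS pnear => z pz.
by apply: pmax; rewrite inE; apply: subset_closure; exact: linked_trans pz.
Qed.

(** Points just above x that can be translated by e without descending all end
up near x + e, hence are linked together. *)
Lemma linked_push h x e : continuous h -> h x < h (x + e) ->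
  \forall y \near x, h x < h y ->
    (forall t, 0 <= t <= 1 -> h y <= h (y + t *: e)) ->
    linked h (h x) (x + e) y.
Proof.
move=> ch hxe; have shift_e : (fun y => y + e) @ x --> x + e.
  by apply: cvgD; [exact: cvg_id | exact: cvg_cst].
have near_xe : \forall y \near x, linked h (h x) (x + e) (y + e).
  exact: shift_e (linked_near (@ch (x + e)) hxe).
apply: filterS near_xe => y xye hxy up; apply: linked_trans xye (linked_sym _).
exact: (@linked_segment _ _ (h y)).
Qed.

End SuperlevelLinks.

(** * Separating the maxima at a level *)

Section Separation.
Context {R : realType} {V : normedModType R}.
Variable h : V -> R.
Hypothesis ch : continuous h.
Hypothesis Kh : forall c, 0 < c -> compact [set x | c <= h x].

Definition all_near_linked (Q : set V) x :=
  \forall y \near x, h x < h y -> exists2 q, Q q & linked h (h x) q y.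

Definition unlinked (Q Q' : set V) c :=
  forall q q', Q q -> Q' q' -> ~ linked h c q q'.

Definition above Q c := [set y | exists2 q, Q q & linked h c q y].

(** Away from height c, linkedness is locally constant; at a point of height c
that is no maximum, the points just above it are all on one side. *)
Lemma unlinked_closure_disjoint (Q Q' : set V) c x :
  Q' `<=` local_max h ->
  unlinked Q Q' c ->
  (h x = c -> ~ local_max h x -> all_near_linked Q x \/ all_near_linked Q' x) ->
  closure (above Q c) x ->
  ~ (closure (above Q' c) `|` (Q' `&` [set y | c <= h y])) x.
Proof.
move=> Qmax sep coh clQ clQ'.
have chx : c <= h x.
  suff : (closure [set y | c <= h y]) x.
    by rewrite -(iffLR (closure_id _)) //; exact: closed_superlevel.
  move: x clQ {coh clQ'}; apply: closureS => y.
  by case=> q _ /linked_sym/linked_gtl/ltW.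
have [chx'|hxc] : c < h x \/ h x = c.
    by move: chx; rewrite le_eqVlt => /orP[/eqP|]; [right|left].
  have xnear := linked_near (@ch x) chx'.
  have [y [[q Qq qy] xy]] := clQ _ xnear.
  case: clQ' => [/(_ _ xnear)[y' [[q' Qq' qy'] xy']]|[Q'x _]].
    apply: (sep _ _ Qq Qq'); apply: linked_trans qy _.
    apply: linked_trans (linked_sym xy) _; apply: linked_trans xy' _.
    exact: linked_sym.
  by apply: (sep _ _ Qq Q'x); apply: linked_trans qy (linked_sym xy).
have nmax : ~ local_max h x.
  move=> /clQ[y [[q _ /linked_sym/linked_gtl +]]].
  by rewrite /= leNgt hxc => ->.
case: clQ' => [clQ'|[/Qmax//]].
case: (coh hxc nmax) => [/clQ'|/clQ] [y [[q Qq qy]]] /=; rewrite hxc.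
  move=> /(_ (linked_gtl (linked_sym qy)))[q' Qq' qy'].
  by apply: (sep _ _ Qq' Qq); apply: linked_trans qy' (linked_sym qy).
move=> /(_ (linked_gtl (linked_sym qy)))[q' Qq' qy'].
by apply: (sep _ _ Qq Qq'); apply: linked_trans qy (linked_sym qy').
Qed.

Lemma unlinkedC Q Q' c : unlinked Q Q' c -> unlinked Q' Q c.
Proof. by move=> sep q q' Qq Qq' /linked_sym; apply: sep. Qed.

(** The points of height at least c split into two disjoint closed sets, one for
each side, which have disjoint open neighbourhoods W and W'.  The points of
height at least c / 2 outside W and W' form a compact set on which h stays
below c, so a superlevel set slightly below c is still contained in W and W',
and no connected subset of it meets both. *)
Lemma unlinked_lower (Q Q' : set V) c : 0 < c ->
  finite_set Q -> finite_set Q' -> Q `&` Q' = set0 ->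
  Q `|` Q' = local_max h ->
  unlinked Q Q' c ->
  (forall x, h x = c -> ~ local_max h x ->
     all_near_linked Q x \/ all_near_linked Q' x) ->
  exists c0, [/\ 0 < c0, c0 < c & unlinked Q Q' c0].
Proof.
move=> c0 finQ finQ' QQ'0 QQ'max sep coh.
(* The maxima of height exactly c are isolated in the superlevel set at c: they
   are not limits of higher points and have to be added by hand. *)
pose side (Q : set V) := closure (above Q c) `|` (Q `&` [set y | c <= h y]).
have closed_ge_h r : closed [set y | r <= h y] by exact: closed_superlevel.
have closed_side Q0 : finite_set Q0 -> closed (side Q0).
  move=> finQ0; apply: closedU; first exact: closed_closure.
  apply: closedI => //; apply: compact_closed; first exact: norm_hausdorff.
  exact: finite_compact.
have sides_disjoint : side Q `&` side Q' = set0.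
  rewrite -subset0 => x [Qx Q'x].
  have Q_max : Q `<=` local_max h by rewrite -QQ'max; apply: subsetUl.
  have Q'_max : Q' `<=` local_max h by rewrite -QQ'max; apply: subsetUr.
  case: (Qx) => [clQ|[Q_x _]].
    by apply: (unlinked_closure_disjoint Q'_max sep (coh x) clQ).
  case: (Q'x) => [clQ'|[Q'_x _]].
    apply: (unlinked_closure_disjoint Q_max (unlinkedC sep) _ clQ') => //.
    by move=> hxc /(coh _ hxc)[]; [right|left].
  by have : (Q `&` Q') x by []; rewrite QQ'0.
have sides_cover x : c <= h x -> (side Q `|` side Q') x.
  rewrite le_eqVlt => /orP[/eqP/esym hxc|chx].
    have [xmax|nmax] := pselect (local_max h x).
      have : (Q `|` Q') x by rewrite QQ'max.
      by case=> [Qx|Qx]; [left|right]; right; split=> //=; rewrite hxc.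
    have near_side Q0 : all_near_linked Q0 x -> side Q0 x.
      move=> nearQ; left=> B Bx; apply: contrapT => nQB; apply: nmax.
      near=> y; rewrite leNgt; apply/negP => hxy; apply: nQB.
      exists y; split; last by near: y.
      by rewrite /= -hxc; move: hxy; near: y.
    by case: (coh x hxc nmax) => /near_side; [left|right].
  have [p pmax xp] := linked_local_max ch (@Kh _ c0) chx.
  have : (Q `|` Q') p by rewrite QQ'max.
  by case=> [Qp|Qp]; [left|right]; left; apply: subset_closure; exists p => //;
    exact: linked_sym.
have [W [W' [oW oW' sideW sideW' WW'0]]] :=
  iffLR (@normal_openP R V) (@pseudometric_normal R V) _ _
    (closed_side _ finQ) (closed_side _ finQ') sides_disjoint.
(* The maxima below c are included so that c1 ends up above them: then a
   maximum of height more than c1 has height at least c and lies on its side. *)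
pose bad := ([set y | c / 2 <= h y] `&` ~` (W `|` W')) `|`
            ((Q `|` Q') `&` [set y | h y < c]).
have bad_lt y : bad y -> h y < c.
  case=> [[_ nW]|[_ //]]; rewrite ltNge; apply/negP => /sides_cover sy.
  by apply: nW; case: sy => [/sideW|/sideW']; [left|right].
have bad_compact : compact bad.
  rewrite /bad; apply: compactU.
    apply: subclosed_compact (@Kh (c / 2) _) _; last by move=> y [].
      apply: closedI => //; apply: open_closedC; exact: openU.
    by rewrite divr_gt0.
  by apply: finite_compact; apply: finite_setIl; rewrite finite_setU.
have [c1 [c1c c2c1 badc1]] : exists c1,
    [/\ c1 < c, c / 2 <= c1 & forall y, bad y -> h y <= c1].
  have [->|/set0P bad0] := eqVneq bad set0.
    by exists (c / 2); split => //; lra.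
  have [b /[!inE] badb bmax] :=
    @compact_EVT_max _ _ h _ bad0 bad_compact (continuous_subspaceT ch).
  exists (Num.max (c / 2) (h b)); split.
  - rewrite gt_max bad_lt// andbT; lra.
  - by rewrite le_max lexx.
  - by move=> y bady; rewrite le_max bmax ?orbT// inE.
exists c1; split => //; first lra.
move=> q q' Qq Qq' [c2 c12 [C [Cconn Cq Cq' Ch]]].
have CWW' : C `<=` W `|` W'.
  move=> y Cy; apply: contrapT => nW.
  have c2y : c2 <= h y := Ch _ Cy.
  have : h y <= c1 by apply: badc1; left; split => //=; lra.
  by lra.
have Cside Q0 y : Q0 `<=` Q `|` Q' -> C y -> Q0 y -> side Q0 y.
  move=> Q0Q Cy Q0y; right; split => //=; rewrite leNgt; apply/negP => hyc.
  have c2y : c2 <= h y := Ch _ Cy.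
  have : h y <= c1 by apply: badc1; right; split => //; exact: Q0Q.
  by lra.
have Wq : W q by apply: sideW; apply: Cside => //; exact: subsetUl.
have Wq' : W' q' by apply: sideW'; apply: Cside => //; exact: subsetUr.
have : C `&` W = C.
  apply: Cconn; first by exists q.
    by exists W.
  exists (~` W'); first exact: open_closedC.
  rewrite predeqE => y; split => -[Cy].
    by move=> Wy; split => // Wy'; have : (W `&` W') y by []; rewrite WW'0.
  by move=> nWy; split => //; case: (CWW' _ Cy).
move=> CW; move: Cq'; rewrite -CW => -[_ Wq'0].
by have : (W `&` W') q' by []; rewrite WW'0.
Unshelve. all: by end_near. Qed.

End Separation.

(** * Counting mountain passes *)

Section MountainPassCount.
Context {R : realType} {V : normedModType R}.
Variable h : V -> R.
Hypothesis ch : continuous h.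
Hypothesis h_gt0 : forall x, 0 < h x.
Hypothesis Kh : forall c, 0 < c -> compact [set x | c <= h x].

(** The height of the point x is the infimum of the levels at which Q and Q' are
not linked. *)
Lemma separation_level (Q Q' : set V) q0 q0' :
  finite_set Q -> finite_set Q' -> Q `|` Q' = local_max h -> Q `&` Q' = set0 ->
  Q q0 -> Q' q0' ->
  exists2 x, ~ local_max h x &
    ~ (all_near_linked h Q x \/ all_near_linked h Q' x).
Proof.
move=> finQ finQ' QQ'max QQ'0 Qq0 Q'q0'.
pose E : set R := [set c | 0 < c /\ unlinked h Q Q' c].
(* Below the minimum m of h on the segment from q0 to q0', the segment links
   these two points. *)
have [m m0 mE] : exists2 m, 0 < m & forall c, E c -> m <= c.
  pose g (t : R) := h (q0 + t *: (q0' - q0)).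
  have cg : continuous g.
    move=> t.
    apply: (@continuous_comp _ _ _ (fun t : R => q0 + t *: (q0' - q0)) h);
      last exact: ch.
    by apply: cvgD; [exact: cvg_cst | apply: cvgZr_tmp; exact: cvg_id].
  have [t _ gt] := @EVT_min R g 0 1 ler01 (continuous_subspaceT cg).
  exists (g t); first exact: h_gt0.
  move=> c [_ sepc]; rewrite leNgt; apply/negP => cgt.
  apply: (sepc _ _ Qq0 Q'q0'); rewrite -[q0'](addrNK q0) addrC.
  by apply: linked_segment cgt _ => s s01; apply: gt; rewrite in_itv.
have [c Ec] : E !=set0.
  have [|p] := @compact_EVT_max _ _ h [set x | h q0 <= h x] _
    (Kh (h_gt0 q0)) (continuous_subspaceT ch).
    by exists q0 => /=.
  rewrite inE => /= hp pmax; exists (h p); split => // q q' _ _ /linked_gtl hpq.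
  have : h q <= h p by apply: pmax; rewrite inE /= (le_trans hp)// ltW.
  by rewrite leNgt hpq.
have infE : has_inf E by split; [exists c | exists m => r /mE].
pose cs := inf E.
have cs0 : 0 < cs.
  by apply: lt_le_trans m0 _; apply: lb_le_inf; [exists c | move=> r /mE].
have Ecs : unlinked h Q Q' cs.
  move=> q q' Qq Qq' [c' csc' [C CP]].
  have e0 : 0 < c' - cs by rewrite subr_gt0.
  have [r [_ sepr]] := inf_adherent e0 infE.
  rewrite addrC subrK => rc'; apply: (sepr _ _ Qq Qq').
  by exists c' => //; exists C.
apply: contrapT => nex.
have [|c0 [c00 c0cs sep0]] :=
  unlinked_lower ch Kh cs0 finQ finQ' QQ'0 QQ'max Ecs.
  by move=> x _ nmax; apply: contrapT => ncoh; apply: nex; exists x.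
have : cs <= c0 by apply: ge_inf => //; exists m => r /mE.
by rewrite leNgt c0cs.
Qed.

(** The local shape of a mountain pass: just above x there are at most two
sides, the one of u and the one of v. *)
Definition two_sided u v x := [/\ h x < h u, h x < h v &
  \forall y \near x, h x < h y -> linked h (h x) u y \/ linked h (h x) v y].

(** Each x in S gives an edge between maxima above its two sides; at every other
point that is no maximum, only one side exists.  If no edge crossed a partition
of the maxima, then no point could see both parts, against
[separation_level]. *)
Theorem size_maxima_le_saddles (P S : seq V) :
  uniq P -> uniq S -> (forall x, x \in P <-> local_max h x) ->
  (forall x, x \in S -> exists u v, two_sided u v x) ->
  (forall x, x \notin P -> x \notin S -> exists u, two_sided u u x) ->
  (size P <= (size S).+1)%N.
Proof.
move=> uP uS Pmax Ssaddle regular.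
have climb x u : h x < h u ->
    exists p : seq_sub P, linked h (h x) (ssval p) u.
  move=> hxu; have [p /Pmax pP up] := linked_local_max ch (Kh (h_gt0 x)) hxu.
  by exists (SeqSub pP) => /=; apply: linked_sym.
have two_maxima u v x : two_sided u v x -> exists p : seq_sub P * seq_sub P,
    \forall y \near x, h x < h y ->
      linked h (h x) (ssval p.1) y \/ linked h (h x) (ssval p.2) y.
  case=> /climb[p pu] /climb[q qv] uvx; exists (p, q).
  apply: filterS uvx => y /= H /H.
  by case=> [uy|vy]; [left; exact: linked_trans pu uy|
                      right; exact: linked_trans qv vy].
have edge (i : seq_sub S) : exists p : seq_sub P * seq_sub P,
    \forall y \near ssval i, h (ssval i) < h y ->
      linked h (h (ssval i)) (ssval p.1) y \/
      linked h (h (ssval i)) (ssval p.2) y.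
  by have [u [v /two_maxima]] := Ssaddle _ (ssvalP i).
have [ab abP] := choice edge.
rewrite -(card_seq_sub uP) -(card_seq_sub uS).
apply: (@card_le_crossing_edges _ _ (fun i => (ab i).1) (fun i => (ab i).2)).
move=> A [p0 p0A] [p1 p1A]; apply: contrapT => ncross.
have same i : ((ab i).1 \in A) = ((ab i).2 \in A).
  by apply: contrapT => /eqP ne; apply: ncross; exists i.
pose side (B : {pred seq_sub P}) := [set x | exists2 p, p \in B & ssval p = x].
have fin_side B : finite_set (side B).
  apply: (@sub_finite_set _ _ [set` P]); last exact: finite_seq.
  by move=> _ [p _ <-]; exact: ssvalP.
have sides_max : side (mem A) `|` side (predC (mem A)) = local_max h.
  rewrite predeqE => x; split => [[] [p _ <-]|/Pmax xP].
  - by apply/Pmax; exact: ssvalP.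
  - by apply/Pmax; exact: ssvalP.
  - by case: (boolP (SeqSub xP \in A)) => xA; [left|right];
    exists (SeqSub xP).
have sides_disjoint : side (mem A) `&` side (predC (mem A)) = set0.
  rewrite -subset0 => x [[p pA <-] [q qA /val_inj qp]].
  by move: qA; rewrite qp !inE /= => /negP.
have [||x nmax] := @separation_level _ _ (ssval p0) (ssval p1)
  (fin_side _) (fin_side _) sides_max sides_disjoint.
- by exists p0.
- by exists p1.
have nP : x \notin P by apply/negP => /Pmax.
have near_side (a b : seq_sub P) : (a \in A) = (b \in A) ->
    (\forall y \near x, h x < h y ->
      linked h (h x) (ssval a) y \/ linked h (h x) (ssval b) y) ->
    all_near_linked h (side (mem A)) x \/
    all_near_linked h (side (predC (mem A))) x.
  move=> ab_eq abx.
  case: (boolP (a \in A)) => aA; [left|right]; apply: filterS abx => y H /H.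
    by case; [exists (ssval a)|exists (ssval b)] => //; [exists a|exists b] =>
      //=; rewrite -ab_eq.
  by case; [exists (ssval a)|exists (ssval b)] => //; [exists a|exists b] => //;
    rewrite inE /= -?ab_eq.
apply; have [xS|xS] := boolP (x \in S).
  exact: (near_side _ _ (same (SeqSub xS)) (abP (SeqSub xS))).
have [u [/climb[p pu] _ uux]] := regular x nP xS.
apply: (near_side p p erefl); apply: filterS uux => y /= H /H.
by case=> uy; left; apply: linked_trans pu uy.
Qed.

End MountainPassCount.

(** * Second-order behaviour near a point *)

(** G v x and H v w x stand for the first derivative of h at x in the direction
v, and for the second derivative in the directions v and w; everything below
follows from the mean value theorem along lines. *)
Section SecondOrder.
Context {R : realType} {V : normedModType R}.
Variables (h : V -> R) (G : V -> V -> R) (H : V -> V -> V -> R).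
Hypothesis ch : continuous h.
Hypothesis Gc : forall v, continuous (G v).
Hypothesis Dh : forall x v t,
  is_derive (t : R) (1 : R) (fun s : R => h (x + s *: v)) (G v (x + t *: v)).
Hypothesis DG : forall x v w t,
  is_derive (t : R) (1 : R) (fun s : R => G w (x + s *: v))
    (H v w (x + t *: v)).
Hypothesis GN : forall v x, G (- v) x = - G v x.
Hypothesis HN : forall v x, H (- v) (- v) x = H v v x.
Hypothesis Hc : forall x e, 0 < e ->
  \forall y \near x, forall v w, `|H v w y - H v w x| <= e * (`|v| * `|w|).

Lemma line_mvt (f g : V -> R) x v (b : R) : 0 < b ->
  (forall t, is_derive (t : R) (1 : R) (fun s : R => f (x + s *: v))
     (g (x + t *: v))) ->
  exists2 c, 0 < c < b & f (x + b *: v) - f x = g (x + c *: v) * b.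
Proof.
move=> b0 df.
have cf : {within `[0, b], continuous (fun s : R => f (x + s *: v))}.
  apply: continuous_subspaceT => t; apply: differentiable_continuous.
  by apply/derivable1_diffP; have [] := df t.
have [c cb] := MVT b0 (fun t _ => df t) cf.
by rewrite scale0r addr0 subr0 => ->; exists c => //; rewrite in_itv in cb.
Qed.

Lemma ler_half_frac (a k : R) : 0 < a -> 0 <= k ->
  a / (2 * (1 + k)) * k <= a / 2.
Proof.
move=> a0 k0; rewrite mulrAC ler_pdivrMr; last lra.
have -> : a / 2 * (2 * (1 + k)) = a * (1 + k) by lra.
by rewrite ler_pM2l//; lra.
Qed.

Lemma short_step (e : V) (r : R) : 0 < r ->
  exists2 s, 0 < s & s * `|e| <= r / 2.
Proof.
move=> r0; exists (r / (2 * (1 + `|e|))); last exact: ler_half_frac.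
by rewrite divr_gt0// mulr_gt0// ltr_pwDl.
Qed.

Lemma increase_along e y s0 : 0 <= G e y ->
  (forall s, 0 < s < s0 -> 0 <= H e e (y + s *: e)) ->
  forall s, 0 <= s <= s0 -> h y <= h (y + s *: e).
Proof.
move=> Gy Hy s /andP[]; rewrite le_eqVlt => /orP[/eqP <- _|s_gt0 ss0].
  by rewrite scale0r addr0.
have [c /andP[c0 cs] E] := line_mvt s_gt0 (Dh y e).
have [c' /andP[c'0 c'c] E'] := line_mvt c0 (DG y e e).
have H'0 : 0 <= H e e (y + c' *: e) by apply: Hy; lra.
have : 0 <= G e (y + c *: e) by have := mulr_ge0 H'0 (ltW c0); lra.
by move=> /mulr_ge0/(_ (ltW s_gt0)); rewrite -E; lra.
Qed.

Lemma H_gt0_near e x : 0 < H e e x -> \forall y \near x, 0 < H e e y.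
Proof.
move=> Hx; pose k := `|e| * `|e|.
have k0 : 0 <= k by rewrite mulr_ge0.
have e0 : 0 < H e e x / (2 * (1 + k)) by rewrite divr_gt0//; lra.
apply: filterS (Hc x e0) => y /(_ e e); rewrite ler_norml => /andP[+ _].
have := ler_half_frac Hx k0.
by rewrite -/k; lra.
Qed.

(** Along e and - e, h is convex near x, so from each y near x it does not
decrease in the one of these directions in which its derivative at y is
nonnegative. *)
Lemma two_sided_convex x e : G e x = 0 -> 0 < H e e x ->
  exists u v, two_sided h u v x.
Proof.
move=> Gx Hx; have /nbhs_ballP[r /= r0 Br] := H_gt0_near Hx.
have [s0 s0_gt0 s0e] := short_step e r0.
have Hball y s : ball x (r / 2) y -> 0 < s < s0 -> 0 < H e e (y + s *: e).
  rewrite -ball_normE /= => xy /andP[s_gt0 ss0].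
  apply: Br; rewrite -ball_normE /=.
  have ss : `|s *: e| <= r / 2.
    rewrite normrZ gtr0_norm// (le_trans _ s0e)// ler_wpM2r//; lra.
  rewrite opprD addrA; apply: le_lt_trans (ler_normB _ _) _; lra.
have HballN y s : ball x (r / 2) y -> 0 < s < s0 ->
    0 < H (- e) (- e) (y + s *: - e).
  rewrite -ball_normE /= => xy /andP[s_gt0 ss0].
  rewrite HN; apply: Br; rewrite -ball_normE /=.
  have ss : `|s *: e| <= r / 2.
    rewrite normrZ gtr0_norm// (le_trans _ s0e)// ler_wpM2r//; lra.
  rewrite scalerN opprB addrCA; apply: le_lt_trans (ler_normD _ _) _; lra.
have r2 : 0 < r / 2 by lra.
have strict w : G w x = 0 -> (forall s, 0 < s < s0 -> 0 < H w w (x + s *: w)) ->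
    h x < h (x + s0 *: w).
  move=> Gw Hw; rewrite -subr_gt0.
  have [c /andP[c0 cs] ->] := line_mvt s0_gt0 (Dh x w).
  have [c' /andP[c'0 c'c]] := line_mvt c0 (DG x w w).
  rewrite Gw subr0 => ->; rewrite !mulr_gt0//; apply: Hw; lra.
have climb w :
    (forall y s, ball x (r / 2) y -> 0 < s < s0 -> 0 < H w w (y + s *: w)) ->
    h x < h (x + s0 *: w) ->
    \forall y \near x, h x < h y -> 0 <= G w y ->
      linked h (h x) (x + s0 *: w) y.
  move=> Hw up; have near_x := nbhsx_ballx x (r / 2) r2.
  apply: filterS2 (linked_push ch up) near_x => y push xy hxy Gy.
  apply: push => // t /andP[t0 t1]; rewrite scalerA.
  apply: (@increase_along _ _ s0) => //.
    by move=> s s0s; apply/ltW/Hw.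
  by apply/andP; split; [rewrite mulr_ge0// ltW | rewrite ler_piMl// ltW].
have up1 : h x < h (x + s0 *: e).
  by apply: strict => // s ?; apply: Hball => //; exact: ballxx.
have up2 : h x < h (x + s0 *: (- e)).
  apply: strict => [|s ?]; first by rewrite GN Gx oppr0.
  by apply: HballN => //; exact: ballxx.
exists (x + s0 *: e), (x + s0 *: - e); split => //.
have := climb _ HballN up2; apply: filterS2 (climb _ Hball up1) => y C1 C2 hxy.
have [Gy|Gy] := leP 0 (G e y); [left; exact: C1|right; apply: C2 => //].
by rewrite GN oppr_ge0 ltW.
Qed.

Lemma two_sided_regular x e : 0 < G e x -> exists u, two_sided h u u x.
Proof.
move=> Gx; have /nbhs_ballP[r /= r0 Br] : \forall y \near x, 0 < G e y.
  by have /cvgr_gt := @Gc e x; apply.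
have [s0 s0_gt0 s0e] := short_step e r0.
have Gball y s : ball x (r / 2) y -> 0 < s < s0 -> 0 < G e (y + s *: e).
  rewrite -ball_normE /= => xy /andP[s_gt0 ss0].
  apply: Br; rewrite -ball_normE /=.
  have ss : `|s *: e| <= r / 2.
    rewrite normrZ gtr0_norm// (le_trans _ s0e)// ler_wpM2r//; lra.
  rewrite opprD addrA; apply: le_lt_trans (ler_normB _ _) _; lra.
have r2 : 0 < r / 2 by lra.
have up y s : ball x (r / 2) y -> 0 < s <= s0 -> h y < h (y + s *: e).
  move=> xy /andP[s_gt0 ss0]; rewrite -subr_gt0.
  have [c /andP[c0 cs] ->] := line_mvt s_gt0 (Dh y e).
  by rewrite mulr_gt0//; apply: Gball => //; rewrite c0 (lt_le_trans cs).
have upx : h x < h (x + s0 *: e).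
  by apply: up; [exact: ballxx | rewrite s0_gt0 lexx].
exists (x + s0 *: e); split => //; have near_x := nbhsx_ballx x (r / 2) r2.
apply: filterS2 (linked_push ch upx) near_x => y push xy hxy; left.
apply: push => // t /andP[]; rewrite le_eqVlt => /orP[/eqP <- _|t0 t1].
  by rewrite scale0r addr0.
rewrite scalerA ltW// up//.
by apply/andP; split; [rewrite mulr_gt0 | rewrite ler_piMl// ltW].
Qed.

Lemma local_max_critical x v : local_max h x -> G v x = 0.
Proof.
move=> xmax; suff G_le0 w : G w x <= 0.
  by apply/eqP; rewrite eq_le G_le0 -oppr_le0 -GN G_le0.
rewrite leNgt; apply/negP => Gx.
have : \forall y \near x, 0 < G w y /\ h y <= h x.
  by apply: filterI => //; have /cvgr_gt := @Gc w x; apply.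
move=> /nbhs_ballP[r /= r0 Br].
have [s0 s0_gt0 s0e] := short_step w r0.
have inb s : 0 < s <= s0 -> ball x r (x + s *: w).
  move=> /andP[s_gt0 ss0].
  rewrite -ball_normE /= opprD addNKr normrN normrZ gtr0_norm//.
  by apply: le_lt_trans (_ : s0 * `|w| < r); [rewrite ler_wpM2r|lra].
have [c /andP[c0 cs] E] := line_mvt s0_gt0 (Dh x w).
have [|_ hs0] := Br (x + s0 *: w); first by apply: inb; rewrite s0_gt0 lexx.
have [|Gc0 _] := Br (x + c *: w); first by apply: inb; rewrite c0 ltW.
by have := mulr_gt0 Gc0 s0_gt0; rewrite -E; lra.
Qed.

(** The second derivative varies by less than the bound m near x, so it stays
negative semidefinite there and h is concave along every segment from x. *)
Lemma local_max_negdef x m : (forall v, G v x = 0) -> 0 < m ->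
  (forall v, H v v x <= - (m * (`|v| * `|v|))) -> local_max h x.
Proof.
move=> Gx m0 Hx; have /nbhs_ballP[r /= r0 Br] := Hc x m0.
apply/nbhs_ballP; exists r => // y; rewrite -ball_normE /= => xy.
have [c /andP[c0 c1]] := line_mvt ltr01 (Dh x (y - x)).
rewrite scale1r subrKC => E.
have [c' /andP[c'0 c'c]] := line_mvt c0 (DG x (y - x) (y - x)).
rewrite Gx subr0 => E'.
have : ball x r (x + c' *: (y - x)).
  rewrite -ball_normE /= opprD addNKr normrN normrZ gtr0_norm// distrC.
  by apply: le_lt_trans xy; rewrite ler_piMl//; lra.
move=> /Br/(_ (y - x) (y - x)); rewrite ler_norml => /andP[_].
have := Hx (y - x) => H1 H2.
have H3 : H (y - x) (y - x) (x + c' *: (y - x)) <= 0 by lra.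
by have := mulr_le0_ge0 H3 (ltW c0); rewrite -E'; lra.
Qed.

(** If y near x were critical too, the derivative in the direction w that is
paired with y - x would vanish at both ends of the segment, although its rate
of change along the segment is positive. *)
Lemma critical_isolated x C : (forall v, G v x = 0) -> 0 < C ->
  (forall v, exists2 w, `|w| <= C * `|v| & `|v| * `|v| <= H v w x) ->
  \forall y \near x, (forall v, G v y = 0) -> y = x.
Proof.
move=> Gx C0 Hx; have e0 : 0 < (2 * C)^-1 by rewrite invr_gt0; lra.
have /nbhs_ballP[r /= r0 Br] := Hc x e0.
apply/nbhs_ballP; exists r => // y; rewrite -ball_normE /= => xy Gy.
have [w wC Hw] := Hx (y - x).
have [c /andP[c0 c1]] := line_mvt ltr01 (DG x (y - x) w).
rewrite scale1r subrKC Gx Gy subrr mulr1 => /esym E.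
have : ball x r (x + c *: (y - x)).
  rewrite -ball_normE /= opprD addNKr normrN normrZ gtr0_norm// distrC.
  by apply: le_lt_trans xy; rewrite ler_piMl//; lra.
move=> /Br/(_ (y - x) w); rewrite E sub0r normrN => Hle.
have : H (y - x) w x <= (`|y - x| * `|y - x|) / 2.
  apply: le_trans (ler_norm _) _; apply: le_trans Hle _.
  rewrite ler_pdivrMl; last by lra.
  have -> : 2 * C * (`|y - x| * `|y - x| / 2) = `|y - x| * (C * `|y - x|).
    by lra.
  by rewrite ler_wpM2l.
move=> Hle2; apply/eqP; rewrite -subr_eq0 -normr_eq0 -sqrf_eq0 expr2.
by rewrite eq_le mulr_ge0// andbT; lra.
Qed.

End SecondOrder.

(** * Bilinear forms on row vectors *)

Section PointwiseContinuity.
Context {R : realType} {T : topologicalType}.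
Implicit Types (f g : T -> R) (x : T).

Lemma eq_continuous_at f g x : f =1 g -> {for x, continuous g} ->
  {for x, continuous f}.
Proof. by move=> /funext ->. Qed.

Lemma continuous_at_cst (U : topologicalType) (a : U) x :
  {for x, continuous (fun _ : T => a)}.
Proof. exact: cvg_cst. Qed.

Lemma continuous_at_mul f g x :
  {for x, continuous f} -> {for x, continuous g} ->
  {for x, continuous (fun y => f y * g y)}.
Proof. exact: continuousM. Qed.

Lemma continuous_at_sub (V : normedModType R) (f g : T -> V) x :
  {for x, continuous f} -> {for x, continuous g} ->
  {for x, continuous (fun y => f y - g y)}.
Proof. exact: continuousB. Qed.

Lemma continuous_at_opp f x : {for x, continuous f} ->
  {for x, continuous (fun y => - f y)}.
Proof. exact: continuousN. Qed.

Lemma continuous_at_comp (U : topologicalType) (f : T -> U) (g : U -> R) x :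
  {for x, continuous f} -> continuous g ->
  {for x, continuous (fun y => g (f y))}.
Proof. by move=> cf cg; apply: continuous_comp cf (@cg (f x)). Qed.

Lemma continuous_at_sum (I : Type) (r : seq I)
    (f : I -> T -> R) (x : T) : (forall i, {for x, continuous (f i)}) ->
  {for x, continuous (fun y => \sum_(i <- r) f i y)}.
Proof.
by move=> cf; apply: cvg_big => [|i _]; [exact: add_continuous | exact: cf].
Qed.

End PointwiseContinuity.

Section Forms.
Context {R : realType} {d : nat}.
Implicit Types (A B : 'M[R]_d) (u v w : 'rV[R]_d).

Definition bform B v w : R := (v *m B *m w^T) 0 0.

Lemma bformE B v w : bform B v w = \sum_j (\sum_i v 0 i * B i j) * w 0 j.
Proof.
by rewrite /bform mxE; apply: eq_bigr => j _; rewrite !mxE.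
Qed.

Lemma quad_formE B v : quad_form B v = bform B v v. Proof. by []. Qed.

Lemma bformDl B u v w : bform B (u + v) w = bform B u w + bform B v w.
Proof. by rewrite /bform !mulmxDl mxE. Qed.

Lemma bformDr B u v w : bform B u (v + w) = bform B u v + bform B u w.
Proof. by rewrite /bform linearD /= mulmxDr mxE. Qed.

Lemma bformZl B a v w : bform B (a *: v) w = a * bform B v w.
Proof. by rewrite /bform -!scalemxAl mxE. Qed.

Lemma bformZr B a v w : bform B v (a *: w) = a * bform B v w.
Proof. by rewrite /bform linearZ /= -!scalemxAr mxE. Qed.

Lemma bformNl B v w : bform B (- v) w = - bform B v w.
Proof. by rewrite -scaleN1r bformZl mulN1r. Qed.

Lemma bformNr B v w : bform B v (- w) = - bform B v w.
Proof. by rewrite -scaleN1r bformZr mulN1r. Qed.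

Lemma bformC B v w : B^T = B -> bform B v w = bform B w v.
Proof.
move=> sB; rewrite /bform -{1}sB.
have <- : (w *m B *m v^T)^T = v *m B^T *m w^T by rewrite !trmx_mul trmxK mulmxA.
by rewrite mxE.
Qed.

Lemma bform_sub A B v w : bform (A - B) v w = bform A v w - bform B v w.
Proof. by rewrite /bform mulmxBr mulmxBl !mxE. Qed.

Lemma bform_opp B v w : bform (- B) v w = - bform B v w.
Proof. by rewrite /bform mulmxN mulNmx mxE. Qed.

Lemma bform_delta B i j : bform B (delta_mx 0 i) (delta_mx 0 j) = B i j.
Proof. by rewrite /bform trmx_delta -rowE -colE !mxE. Qed.

Lemma coord_le_norm v j : `|v 0 j| <= `|v|.
Proof.
have : `|v 0 j : R| \in [seq `|v x.1 x.2| | x : 'I_1 * 'I_d].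
  by apply/mapP; exists (ord0, j) => //=; rewrite mem_enum.
move=> /mapP[k _ ->].
rewrite [leRHS]/Num.norm /= mx_normrE; apply/bigmax_geP; right => /=.
by exists k.
Qed.

Lemma norm_le_coord v M : 0 <= M -> (forall j, `|v 0 j| <= M) -> `|v| <= M.
Proof.
move=> M0 vM; rewrite [leLHS]/Num.norm /= mx_normrE.
by apply/bigmax_leP; split => //= -[i j] _ /=; rewrite (ord1 i).
Qed.

Lemma bform_bound B v w :
  `|bform B v w| <= (\sum_j \sum_i `|B i j|) * (`|v| * `|w|).
Proof.
rewrite bformE mulr_suml; apply: le_trans (ler_norm_sum _ _ _) _.
apply: ler_sum => j _; rewrite normrM mulrA ler_pM ?coord_le_norm//.
rewrite mulr_suml; apply: le_trans (ler_norm_sum _ _ _) _.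
by apply: ler_sum => i _; rewrite normrM mulrC ler_wpM2l ?coord_le_norm.
Qed.

Lemma coord_cvg (T : topologicalType) (f : T -> 'rV[R]_d) (x : T) j :
  {for x, continuous f} -> {for x, continuous (fun y => f y 0 j)}.
Proof.
move=> cf; apply: (@continuous_comp _ _ _ f (fun v => v 0 j)) => //.
exact: coord_continuous.
Qed.

Lemma bform_continuous B (T : topologicalType) (f g : T -> 'rV[R]_d) (x : T) :
  {for x, continuous f} -> {for x, continuous g} ->
  {for x, continuous (fun y => bform B (f y) (g y))}.
Proof.
move=> cf cg; apply: eq_continuous_at => [y|]; first exact: bformE.
apply: continuous_at_sum => j; apply: continuous_at_mul; last exact: coord_cvg.
apply: continuous_at_sum => i; apply: continuous_at_mul; first exact: coord_cvg.
exact: continuous_at_cst.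
Qed.

(** The constant m is the minimum of the quadratic form on the unit sphere. *)
Lemma posdef_coercive B : (forall v, v != 0 -> 0 < bform B v v) ->
  exists2 m, 0 < m & forall v, m * (`|v| * `|v|) <= bform B v v.
Proof.
move=> Bpos; pose sphere := [set v : 'rV[R]_d | `|v| = 1].
have [S0|/set0P S0] := eqVneq sphere set0.
  exists 1 => // v; have [->|v0] := eqVneq v 0.
    by rewrite normr0 mulr0 mulr0 /bform !mul0mx mxE.
  have : sphere (`|v|^-1 *: v).
    by rewrite /sphere /= normrZ normfV normr_id mulVf// normr_eq0.
  by rewrite S0.
have csphere : compact sphere.
  apply: bounded_closed_compact.
    by exists 1; split => // r r1 v /= ->; exact: ltW.
  apply: (@preimage_closed _ _ (fun v : 'rV[R]_d => `|v|) [set x | x = 1]).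
    by move=> v _; exact: norm_continuous.
  exact: closed_eq.
have cB : continuous (fun v => bform B v v).
  by move=> v; apply: bform_continuous; exact: cvg_id.
have [u] := @EVT_min_rV R d _ _ S0 csphere (continuous_subspaceT cB).
rewrite inE => u1 umin; exists (bform B u u).
  by apply: Bpos; rewrite -normr_eq0 u1 oner_eq0.
move=> v; have [->|v0] := eqVneq v 0.
  by rewrite normr0 mulr0 mulr0 /bform !mul0mx mxE.
have nv : `|v| != 0 by rewrite normr_eq0.
have vE : v = `|v| *: (`|v|^-1 *: v) by rewrite scalerA mulfV// scale1r.
rewrite [in leRHS]vE bformZl bformZr mulrC [leRHS]mulrA.
apply: ler_wpM2l; first by rewrite mulr_ge0.
by apply: umin; rewrite inE /sphere /= normrZ normfV normr_id mulVf.
Qed.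

Lemma unitmx_inj A : (forall v, v *m A = 0 -> v = 0) -> A \in unitmx.
Proof.
move=> Ainj; rewrite -row_free_unit -kermx_eq0; apply/eqP/row_matrixP => i.
rewrite row0; apply: Ainj; rewrite -row_mul mulmx_ker; exact: row0.
Qed.

Lemma posdef_unitmx A : posdef A -> A \in unitmx.
Proof.
case=> _ Apos; apply: unitmx_inj => v vA; apply/eqP; apply: contraT => /Apos.
by rewrite /quad_form vA mul0mx mxE ltxx.
Qed.

Lemma posdef_invmx A : posdef A -> posdef (invmx A).
Proof.
move=> pA; have Au := posdef_unitmx pA; have [sA Apos] := pA.
split; first by rewrite trmx_inv sA.
move=> v v0; have vE : v = v *m invmx A *m A by rewrite mulmxKV.
have w0 : v *m invmx A != 0.
  by apply: contra_neq v0 => w0; rewrite vE w0 mul0mx.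
rewrite /quad_form {2}vE trmx_mul sA mulmxA; exact: Apos.
Qed.

(** An isotropic vector v of a semidefinite form lies in its kernel, because the
form at v + t w is at most 0 for every real t. *)
Lemma negsemidef_unit_negdef A : A^T = A -> A \in unitmx ->
  (forall v, bform A v v <= 0) -> forall v, v != 0 -> bform A v v < 0.
Proof.
move=> sA uA Aneg v v0; rewrite lt_neqAle Aneg andbT; apply/eqP => Av0.
have vA0 w : bform A v w = 0.
  apply/eqP; apply: contraT => b0; pose b := bform A v w; pose a := bform A w w.
  have key t : 2 * t * b + t ^+ 2 * a <= 0.
    have := Aneg (v + t *: w).
    rewrite bformDl !bformDr !bformZl !bformZr (bformC w v sA) Av0 -/a -/b.
    by lra.
  have a0 : a <= 0 := Aneg w.
  have [a00|an0] := eqVneq a 0.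
    have := key b; rewrite a00 mulr0 addr0.
    have : 0 < b * b by rewrite -expr2 exprn_even_gt0.
    by lra.
  (* The value t = - b / a maximizes the quadratic polynomial in [key]. *)
  have := key (- b / a).
  have -> : 2 * (- b / a) * b + (- b / a) ^+ 2 * a = - (b ^+ 2 / a) by field.
  rewrite oppr_le0 => H1.
  have : b ^+ 2 / a < 0.
    by rewrite pmulr_rlt0 ?invr_lt0 ?exprn_even_gt0// lt_neqAle an0.
  by lra.
have : v *m A = 0.
  apply/rowP => j; have := vA0 (delta_mx 0 j).
  by rewrite /bform trmx_delta -colE !mxE.
move=> /(congr1 (mulmx^~ (invmx A))); rewrite mulmxK// mul0mx => /eqP.
by rewrite (negbTE v0).
Qed.

End Forms.

(** * Derivatives of a sum of Gaussians *)

Section GaussianSum.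
Context {R : realType} {d k : nat}.
Variables (c : 'I_k -> R) (mu : 'I_k -> 'rV[R]_d) (B : 'I_k -> 'M[R]_d).

Definition gaussian_term i (x : 'rV[R]_d) : R :=
  c i * expR (- (1 / 2) * quad_form (B i) (x - mu i)).

Definition gaussian_sum x := \sum_(i < k) gaussian_term i x.

Definition gaussian_sum_grad x : 'rV[R]_d :=
  \sum_(i < k) gaussian_term i x *: - ((x - mu i) *m B i).

Definition gaussian_sum_hess x : 'M[R]_d :=
  \sum_(i < k) gaussian_term i x *:
    (B i *m (x - mu i)^T *m ((x - mu i) *m B i) - B i).

Definition dirgrad (v x : 'rV[R]_d) : R := (gaussian_sum_grad x *m v^T) 0 0.

Lemma dirgradE v x :
  dirgrad v x = \sum_(i < k) gaussian_term i x * - bform (B i) (x - mu i) v.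
Proof.
rewrite /dirgrad mulmx_suml summxE; apply: eq_bigr => i _.
by rewrite -scalemxAl mxE mulNmx mxE.
Qed.

Lemma dirhessE v w x : bform (gaussian_sum_hess x) v w =
  \sum_(i < k) gaussian_term i x *
    (bform (B i) v (x - mu i) * bform (B i) (x - mu i) w - bform (B i) v w).
Proof.
rewrite {1}/bform mulmx_sumr mulmx_suml summxE; apply: eq_bigr => i _.
rewrite -scalemxAr -scalemxAl mxE; congr (_ * _).
rewrite -/(bform _ v w) bform_sub; congr (_ - _); rewrite /bform.
have -> : v *m (B i *m (x - mu i)^T *m ((x - mu i) *m B i)) *m w^T =
    (v *m B i *m (x - mu i)^T) *m ((x - mu i) *m B i *m w^T) by rewrite !mulmxA.
by rewrite mxE big_ord1.
Qed.

(** The affine factor makes one computation serve both derivatives: along a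
line, h is a sum of such terms with affine factor 1, and so is each directional
derivative of h with a general affine factor. *)
Lemma gauss_line_derive (a q0 q1 q2 l0 l1 t : R) :
  is_derive t 1 (fun s =>
      a * expR (- (1 / 2) * (q0 + 2 * (s * q1) + s ^+ 2 * q2)) * (l0 + s * l1))
    (a * expR (- (1 / 2) * (q0 + 2 * (t * q1) + t ^+ 2 * q2)) *
      (l1 - (q1 + t * q2) * (l0 + t * l1))).
Proof.
pose p : R -> R :=
  cst (- (1 / 2)) * (cst q0 + cst 2 * (id * cst q1) + id ^+ 2 * cst q2).
have dp : is_derive t 1 p (- (1 / 2) * (2 * q1 + 2 * t * q2)).
  apply: is_derive_eq; rewrite /GRing.scale /= !fctE /=; ring.
have de : is_derive t 1 (expR \o p)
    (expR (p t) * (- (1 / 2) * (2 * q1 + 2 * t * q2))).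
  exact: is_derive1_comp.
pose l : R -> R := cst l0 + id * cst l1.
have dl : is_derive t 1 (cst a * (expR \o p) * l) (a * expR (p t) *
      (l1 - (q1 + t * q2) * (l0 + t * l1))).
  apply: is_derive_eq; rewrite /GRing.scale /= /l !fctE /=; by field.
exact: dl.
Qed.

Hypothesis sB : forall i, (B i)^T = B i.

Lemma gaussian_term_line i x v (s : R) : gaussian_term i (x + s *: v) =
  c i * expR (- (1 / 2) * (bform (B i) (x - mu i) (x - mu i)
    + 2 * (s * bform (B i) (x - mu i) v) + s ^+ 2 * bform (B i) v v)).
Proof.
rewrite /gaussian_term; congr (_ * expR (_ * _)).
rewrite addrAC quad_formE; move: (x - mu i) => y.
rewrite bformDl !bformDr !bformZl !bformZr.
by rewrite (bformC v y (sB i)); ring.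
Qed.

Lemma is_derive_sum_fun (f : 'I_k -> R -> R) (df : 'I_k -> R) (t : R) :
  (forall i, is_derive t 1 (f i) (df i)) ->
  is_derive t 1 (fun s => \sum_(i < k) f i s) (\sum_(i < k) df i).
Proof.
move=> Df; rewrite (_ : (fun s => _) = \sum_(i < k) f i).
  exact: is_derive_sum.
by apply/funext => s; rewrite fct_sumE.
Qed.

Lemma gaussian_sum_line_derive x v (t : R) :
  is_derive t 1 (fun s : R => gaussian_sum (x + s *: v))
    (dirgrad v (x + t *: v)).
Proof.
rewrite dirgradE; apply: is_derive_sum_fun => i.
have := gauss_line_derive (c i) (bform (B i) (x - mu i) (x - mu i))
  (bform (B i) (x - mu i) v) (bform (B i) v v) 1 0 t.
under eq_fun do rewrite mulr0 addr0 mulr1 -gaussian_term_line.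
move=> /is_derive_eq; apply; rewrite -gaussian_term_line; congr (_ * _).
by rewrite [x + _ - _]addrAC !bformDl bformZl; ring.
Qed.

Lemma dirgrad_line_derive x v w (t : R) :
  is_derive t 1 (fun s : R => dirgrad w (x + s *: v))
    (bform (gaussian_sum_hess (x + t *: v)) v w).
Proof.
under eq_fun do rewrite dirgradE.
rewrite dirhessE; apply: is_derive_sum_fun => i.
have := gauss_line_derive (c i) (bform (B i) (x - mu i) (x - mu i))
  (bform (B i) (x - mu i) v) (bform (B i) v v)
  (- bform (B i) (x - mu i) w) (- bform (B i) v w) t.
have lin (s : R) : - bform (B i) (x - mu i) w + s * - bform (B i) v w =
    - bform (B i) (x + s *: v - mu i) w.
  by rewrite [x + _ - _]addrAC !bformDl bformZl; ring.
under eq_fun do rewrite lin -gaussian_term_line.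
move=> /is_derive_eq; apply; rewrite -gaussian_term_line; congr (_ * _).
rewrite lin (bformC v (x + t *: v - mu i) (sB i)) [x + _ - _]addrAC.
by rewrite !bformDl !bformZl; ring.
Qed.

Lemma shift_continuous_at i (x : 'rV[R]_d) :
  {for x, continuous (fun y : 'rV[R]_d => y - mu i)}.
Proof.
apply: continuous_at_sub; last exact: continuous_at_cst.
exact: cvg_id.
Qed.

Lemma bform_shift_continuous_at i v (x : 'rV[R]_d) :
  {for x, continuous (fun y : 'rV[R]_d => bform (B i) (y - mu i) v)}.
Proof.
apply: bform_continuous; first exact: shift_continuous_at.
exact: continuous_at_cst.
Qed.

Lemma gaussian_term_continuous_at i (x : 'rV[R]_d) :
  {for x, continuous (gaussian_term i)}.
Proof.
apply: continuous_at_mul; first exact: continuous_at_cst.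
apply: continuous_at_comp; last exact: continuous_expR.
apply: continuous_at_mul; first exact: continuous_at_cst.
by apply: bform_continuous; exact: shift_continuous_at.
Qed.

Lemma gaussian_sum_continuous : continuous gaussian_sum.
Proof.
by move=> x; apply: continuous_at_sum => i; exact: gaussian_term_continuous_at.
Qed.

Lemma dirgrad_continuous v : continuous (dirgrad v).
Proof.
move=> x; apply: eq_continuous_at => [y|]; first exact: dirgradE.
apply: continuous_at_sum => i.
apply: continuous_at_mul; first exact: gaussian_term_continuous_at.
apply: continuous_at_opp; exact: bform_shift_continuous_at.
Qed.

Lemma dirhess_continuous_at v w (x : 'rV[R]_d) :
  {for x, continuous (fun y => bform (gaussian_sum_hess y) v w)}.
Proof.
apply: eq_continuous_at => [y|]; first exact: dirhessE.
apply: continuous_at_sum => i.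
apply: continuous_at_mul; first exact: gaussian_term_continuous_at.
apply: continuous_at_sub; last exact: continuous_at_cst.
apply: continuous_at_mul; last exact: bform_shift_continuous_at.
apply: eq_continuous_at => [y|]; first exact: bformC.
exact: bform_shift_continuous_at.
Qed.

Lemma hess_near (x : 'rV[R]_d) e : 0 < e -> \forall y \near x, forall v w,
  `|bform (gaussian_sum_hess y) v w - bform (gaussian_sum_hess x) v w| <=
    e * (`|v| * `|w|).
Proof.
move=> e0.
pose g y := \sum_j \sum_i `|(gaussian_sum_hess y - gaussian_sum_hess x) i j|.
have gc : {for x, continuous g}.
  apply: continuous_at_sum => j; apply: continuous_at_sum => i.
  apply: continuous_at_comp; last exact: norm_continuous.
  apply: eq_continuous_at => [y|].
    by rewrite -bform_delta bform_sub.
  apply: continuous_at_sub; last exact: continuous_at_cst.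
  exact: dirhess_continuous_at.
have gx : g x = 0.
  by rewrite /g big1// => j _; rewrite big1// => i _; rewrite subrr mxE normr0.
have : \forall y \near x, g y < e by have /cvgr_lt := gc; apply; rewrite gx.
apply: filterS => y ge v w; rewrite -bform_sub.
apply: le_trans (bform_bound _ _ _) _.
by apply: ler_wpM2r; [rewrite mulr_ge0 | exact: ltW].
Qed.

Lemma dirgradN v x : dirgrad (- v) x = - dirgrad v x.
Proof. by rewrite /dirgrad linearN /= mulmxN mxE. Qed.

Lemma trmx_gaussian_sum_hess x : (gaussian_sum_hess x)^T = gaussian_sum_hess x.
Proof.
rewrite /gaussian_sum_hess linear_sum; apply: eq_bigr => i _ /=.
rewrite linearZ /= linearB /= !trmx_mul trmxK sB; congr (_ *: (_ - _)).
Qed.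

End GaussianSum.

Lemma derive_from_line {R : realType} {V : normedModType R}
    (f : V -> R) x v (df : R) :
  is_derive (0 : R) (1 : R) (fun s : R => f (x + s *: v)) df -> 'D_v f x = df.
Proof.
move=> dfx; rewrite -[RHS](@derive_val _ _ _ _ _ _ _ dfx) /derive.
have -> // : (fun s : R => s^-1 *: ((f \o shift x) (s *: v) - f x)) =
  (fun s : R => s^-1 *: (((fun s : R => f (x + s *: v)) \o shift 0) (s *: 1) -
    f (x + 0 *: v))).
apply/funext => s /=.
by rewrite scale0r addr0 /GRing.scale /= mulr1 addr0 [x + _]addrC.
Qed.

Section GaussianSumDerivatives.
Context {R : realType} {d k : nat}.
Variables (c : 'I_k -> R) (mu : 'I_k -> 'rV[R]_d) (B : 'I_k -> 'M[R]_d).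
Hypothesis sB : forall i, (B i)^T = B i.

Lemma derive_gaussian_sum v x :
  'D_v (gaussian_sum c mu B) x = dirgrad c mu B v x.
Proof.
apply: derive_from_line; have := gaussian_sum_line_derive c mu sB x v 0.
by rewrite scale0r addr0.
Qed.

Lemma gradient_gaussian_sum x :
  gradient (gaussian_sum c mu B) x = gaussian_sum_grad c mu B x.
Proof.
apply/rowP => j; rewrite !mxE derive_gaussian_sum /dirgrad trmx_delta -colE mxE.
by [].
Qed.

Lemma hessian_gaussian_sum x :
  hessian (gaussian_sum c mu B) x = gaussian_sum_hess c mu B x.
Proof.
apply/matrixP => i j; rewrite mxE -bform_delta.
rewrite (_ : 'D_('e_j) (gaussian_sum c mu B) = dirgrad c mu B 'e_j); last first.
  by apply/funext => y; exact: derive_gaussian_sum.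
apply: derive_from_line; have := dirgrad_line_derive c mu sB x 'e_i 'e_j 0.
by rewrite scale0r addr0.
Qed.

Lemma critical_gaussian_sumP x : critical_points (gaussian_sum c mu B) x <->
  forall v, dirgrad c mu B v x = 0.
Proof.
rewrite /critical_points /= gradient_gaussian_sum; split => [x0 v|x0].
  by rewrite /dirgrad x0 mul0mx mxE.
apply/rowP => j; have := x0 'e_j.
by rewrite /dirgrad trmx_delta -colE !mxE.
Qed.

End GaussianSumDerivatives.

(** * Finiteness and local maxima in row-vector space *)

Lemma finite_compact_isolated {R : realType} {V : normedModType R} (K : set V) :
  compact K -> (forall x, K x -> \forall y \near x, K y -> y = x) ->
  finite_set K.
Proof.
rewrite compact_cover => cK isolated.
pose U (x : V) : set V := interior [set y | K y -> y = x].
have [|x Kx|D _ KD] := cK V K U.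
- by move=> x _; exact: open_interior.
- by exists x => //; exact: isolated.
apply: (@sub_finite_set _ _ [set` D]); last exact: finite_fset.
by move=> y Ky; have [x xD /interior_subset/(_ Ky) ->] := KD _ Ky.
Qed.

Lemma card_set_seq {T : choiceType} (s : seq T) :
  uniq s -> [set` s] #= `I_(size s).
Proof.
move=> us; rewrite (_ : [set` s] = [set` [fset x in s]%fset]).
  by apply/card_eq_fsetP; rewrite card_fseq undup_id.
by rewrite predeqE => x; split; rewrite /= !inE.
Qed.

Section RowVectors.
Context {R : realType} {d : nat}.
Implicit Types (x y v w : 'rV[R]_d).

Lemma norm_le_euclidean v : `|v| <= euclidean_norm v.
Proof.
apply: norm_le_coord; first exact: sqrtr_ge0.
move=> j; rewrite -sqrtr_sqr ler_wsqrtr//.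
by rewrite (bigD1 j)//= lerDl sumr_ge0// => i _; exact: sqr_ge0.
Qed.

Lemma norm2_le_bform1 v : `|v| * `|v| <= bform 1%:M v v.
Proof.
have -> : bform 1%:M v v = \sum_i v 0 i ^+ 2.
  by rewrite /bform mulmx1 mxE; apply: eq_bigr => i _; rewrite mxE expr2.
rewrite -expr2 -[leRHS]sqr_sqrtr ?sumr_ge0// => [|i _]; last exact: sqr_ge0.
by rewrite ler_pXn2r ?nnegrE ?sqrtr_ge0//; exact: norm_le_euclidean.
Qed.

Lemma local_maximaP (h : 'rV[R]_d -> R) x : local_maxima h x <-> local_max h x.
Proof.
split=> [[r [r0 hr]]|/nbhs_ballP[r /= r0 hr]]; last first.
  exists r; split => // y xy; apply: hr; rewrite -ball_normE /= distrC.
  exact: le_lt_trans (norm_le_euclidean _) xy.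
have gc : {for x, continuous (fun y => \sum_(i < d) (y - x) 0 i * (y - x) 0 i)}.
  have cj j : {for x, continuous (fun y : 'rV[R]_d => (y - x) 0 j)}.
    apply: coord_cvg; apply: continuous_at_sub; last exact: continuous_at_cst.
    exact: cvg_id.
  by apply: continuous_at_sum => i; apply: continuous_at_mul; exact: cj.
have : \forall y \near x, \sum_(i < d) (y - x) 0 i * (y - x) 0 i < r ^+ 2.
  have /cvgr_lt := gc; apply; rewrite big1 ?exprn_gt0// => i _.
  by rewrite subrr mxE mul0r.
apply: filterS => y hy; apply: hr.
by rewrite /euclidean_norm -(gtr0_norm r0) -sqrtr_sqr ltr_sqrt ?exprn_gt0.
Qed.

(** The vector paired with v is v times the inverse of A, for which the form
takes the value of the Euclidean square of v. *)
Lemma sym_unit_pairing (A : 'M[R]_d) : A^T = A -> A \in unitmx ->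
  exists2 C, 0 < C & forall v, exists2 w,
    `|w| <= C * `|v| & `|v| * `|v| <= bform A v w.
Proof.
move=> sA uA; pose s := \sum_j \sum_i `|invmx A i j|.
have s0 : 0 <= s by apply: sumr_ge0 => j _; apply: sumr_ge0.
exists (s + 1) => [|v]; first by lra.
exists (v *m invmx A).
  apply: norm_le_coord => [|j]; first by rewrite mulr_ge0//; lra.
  have -> : (v *m invmx A) 0 j = bform (invmx A) v (delta_mx 0 j).
    by rewrite /bform trmx_delta -colE !mxE.
  apply: le_trans (bform_bound _ _ _) _; rewrite -/s mulrA.
  have : `|delta_mx 0 j : 'rV[R]_d| <= 1.
    apply: norm_le_coord => // i; rewrite mxE.
    by case: (_ && _); rewrite ?normr1 ?normr0.
  have sv0 : 0 <= s * `|v| by rewrite mulr_ge0.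
  move=> /(ler_wpM2l sv0); rewrite mulr1 => /le_trans; apply.
  by rewrite ler_wpM2r//; lra.
apply: le_trans (norm2_le_bform1 v) _.
by rewrite /bform trmx_mul trmx_inv sA mulmxA mulmxK// mulmx1.
Qed.

Lemma eventually_all (k : nat) (P : 'I_k -> 'rV[R]_d -> Prop) :
  (forall i, exists a : R, forall x, a < `|x| -> P i x) ->
  exists a : R, forall x, a < `|x| -> forall i, P i x.
Proof.
move=> /choice[a Pa]; exists (\sum_i `|a i|) => x ax i; apply: Pa.
apply: le_lt_trans ax; apply: le_trans (ler_norm _) _.
by rewrite (bigD1 i)//= lerDl sumr_ge0.
Qed.

Lemma bounded_outside (K : set 'rV[R]_d) (a : R) :
  (forall x, a < `|x| -> ~ K x) -> bounded_set K.
Proof.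
move=> Ka; exists a; split; first exact: num_real.
move=> b ab x Kx /=.
rewrite leNgt; apply/negP => bx; apply: (Ka x) => //; exact: lt_trans bx.
Qed.

End RowVectors.

(** * Sums of Gaussians with positive weights *)

Section PositiveGaussianSum.
Context {R : realType} {d k : nat}.
Variables (c : 'I_k -> R) (mu : 'I_k -> 'rV[R]_d) (B : 'I_k -> 'M[R]_d).
Hypothesis c_gt0 : forall i, 0 < c i.
Hypothesis pB : forall i, posdef (B i).
Hypothesis k_gt0 : (0 < k)%N.

Let sB i : (B i)^T = B i. Proof. by case: (pB i). Qed.

Let coercive i :
  exists2 m, 0 < m & forall v, m * (`|v| * `|v|) <= bform (B i) v v.
Proof. by apply: posdef_coercive; case: (pB i). Qed.

Local Notation h := (gaussian_sum c mu B).
Local Notation G := (dirgrad c mu B).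

Let hc : continuous h := @gaussian_sum_continuous R d k c mu B.
Let Gc v : continuous (G v) := @dirgrad_continuous R d k c mu B v.
Let Dh := gaussian_sum_line_derive c mu sB.
Let DG := dirgrad_line_derive c mu sB.
Let GN := dirgradN c mu B.
Let Hc x e := @hess_near R d k c mu B sB x e.
Let critP := critical_gaussian_sumP c mu sB.

Lemma gaussian_term_gt0 i x : 0 < gaussian_term c mu B i x.
Proof. by rewrite mulr_gt0 ?expR_gt0. Qed.

Lemma gaussian_sum_gt0 x : 0 < h x.
Proof.
rewrite /gaussian_sum (bigD1 (Ordinal k_gt0))//=.
apply: ltr_pwDl; first exact: gaussian_term_gt0.
by apply: sumr_ge0 => i _; apply/ltW/gaussian_term_gt0.
Qed.

Lemma gaussian_term_decay i e : 0 < e ->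
  exists a : R, forall x, a < `|x| -> gaussian_term c mu B i x < e.
Proof.
(* It suffices that the quadratic form exceeds 2 c / e, as exp t >= 1 + t; the
   summand 1 in the radius gives |x - mu|^2 >= |x - mu|. *)
move=> e0; have [m m0 Bm] := coercive i; pose r := 2 * c i / (e * m).
have r0 : 0 < r by rewrite divr_gt0 ?mulr_gt0.
exists (`|mu i| + 1 + r) => x xr; rewrite /gaussian_term quad_formE.
have xmu : 1 + r < `|x - mu i|.
  by apply: lt_le_trans (lerB_dist _ _); lra.
have q_ge : m * r <= bform (B i) (x - mu i) (x - mu i).
  apply: le_trans (Bm _); rewrite ler_pM2l//.
  apply: le_trans (_ : 1 * `|x - mu i| <= _); first by lra.
  by rewrite ler_wpM2r//; lra.
have mr : e * (m * r) = 2 * c i.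
  by rewrite /r; field; apply/andP; split; rewrite gt_eqF.
set q := bform _ _ _ in q_ge *.
have -> : - (1 / 2) * q = - (q / 2) by lra.
rewrite expRN ltr_pdivrMr ?expR_gt0//.
apply: lt_le_trans (_ : e * (1 + q / 2) <= _).
  have : e * (m * r) <= e * q by rewrite ler_pM2l.
  lra.
by rewrite ler_pM2l// expR_ge1Dx.
Qed.

Lemma gaussian_sum_superlevel_compact e : 0 < e -> compact [set x | e <= h x].
Proof.
move=> e0; have ek : 0 < e / k%:R by rewrite divr_gt0// ltr0n.
have [a small] := eventually_all (fun i => gaussian_term_decay i ek).
apply: bounded_closed_compact; last first.
  apply: (@preimage_closed _ _ h [set r | e <= r]); last exact: closed_ge.
  by move=> x _; exact: gaussian_sum_continuous.
apply: (@bounded_outside _ _ _ a) => x /small sx /=.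
apply/negP; rewrite -ltNge.
have -> : e = \sum_(i < k) e / k%:R.
  by rewrite sumr_const card_ord -[_ / _ *+ _]mulr_natr divfK// pnatr_eq0 -lt0n.
by apply: ltr_sum => //; apply/hasP; exists (Ordinal k_gt0) => //.
Qed.

(** Polarization: with B the form and q its quadratic form,
2 B(x - mu, x) = q(x) + q(x - mu) - q(mu), and q(x) outgrows q(mu). *)
Lemma radial_pairing_gt0 i : exists a : R, forall x, a < `|x| ->
  0 < bform (B i) (x - mu i) x.
Proof.
have [m m0 Bm] := coercive i; set qm := bform (B i) (mu i) (mu i).
exists (1 + `|qm| / m) => x xr.
have a0 : 0 <= `|qm| / m by rewrite divr_ge0// ltW.
have : 0 <= bform (B i) (x - mu i) (x - mu i).
  by apply: le_trans (Bm _); rewrite mulr_ge0 ?mulr_ge0// ltW.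
have : qm < bform (B i) x x.
  apply: lt_le_trans (Bm x); apply: le_lt_trans (ler_norm _) _.
  have -> : `|qm| = m * (`|qm| / m) by rewrite mulrC divfK// gt_eqF.
  rewrite ltr_pM2l//; apply: lt_le_trans (_ : 1 * `|x| <= _); first by lra.
  by rewrite ler_wpM2r//; lra.
rewrite !bformDl !bformDr !bformNl !bformNr (bformC x (mu i) (sB i)) -/qm.
lra.
Qed.

Lemma gaussian_sum_critical_bounded : bounded_set (critical_points h).
Proof.
have [a far] := eventually_all radial_pairing_gt0.
apply: (@bounded_outside _ _ _ a) => x /far xfar /critP/(_ x).
rewrite dirgradE => /eqP; rewrite lt_eqF//.
rewrite -oppr_gt0 -sumrN (bigD1 (Ordinal k_gt0))//=; apply: ltr_pwDl.
  by rewrite mulrN opprK mulr_gt0 ?gaussian_term_gt0.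
apply: sumr_ge0 => i _.
by rewrite mulrN opprK mulr_ge0// ltW ?gaussian_term_gt0.
Qed.

Lemma gaussian_sum_critical_closed : closed (critical_points h).
Proof.
rewrite (_ : critical_points h = \bigcap_(v in setT) [set x | G v x = 0]);
    last first.
  rewrite predeqE => x; split => [/critP Gx v _ //|Gx].
  by apply/critP => v; exact: Gx.
apply: closed_bigI => v _.
apply: (@preimage_closed _ _ (G v) [set r | r = 0]); last exact: closed_eq.
by move=> x _; exact: dirgrad_continuous.
Qed.

Lemma gaussian_sum_critical_finite : morse h -> finite_set (critical_points h).
Proof.
move=> hmorse; apply: finite_compact_isolated => [|x xcrit].
  apply: bounded_closed_compact; first exact: gaussian_sum_critical_bounded.
  exact: gaussian_sum_critical_closed.
have := hmorse x xcrit.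
rewrite /Defs.nondegenerate hessian_gaussian_sum// => uH.
have [C C0 HC] := sym_unit_pairing (trmx_gaussian_sum_hess c mu sB x) uH.
have Gx := (critP x).1 xcrit.
have := critical_isolated DG
  Hc Gx C0 HC.
by apply: filterS => y yx /critP; exact: yx.
Qed.

(** Without such a direction the Hessian would be negative semidefinite, hence
negative definite as it is nonsingular, and x would be a maximum. *)
Lemma saddle_convex_direction x :
  critical_points h x -> Defs.nondegenerate h x ->
  ~ local_max h x -> exists e, 0 < bform (gaussian_sum_hess c mu B x) e e.
Proof.
move=> xcrit; rewrite /Defs.nondegenerate hessian_gaussian_sum// => uH nmax.
apply: contrapT => noe; apply: nmax.
have Hneg := negsemidef_unit_negdef (trmx_gaussian_sum_hess c mu sB x) uH
  (fun v => eqbRL (leNgt _ _) (introT negP (fun Hv => noe (ex_intro _ v Hv)))).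
have [m m0 Hm] : exists2 m, 0 < m & forall v,
    m * (`|v| * `|v|) <= bform (- gaussian_sum_hess c mu B x) v v.
  apply: posdef_coercive => v v0.
  by rewrite bform_opp oppr_gt0; exact: Hneg.
have Gx := (critP x).1 xcrit.
apply: (local_max_negdef Dh DG
  Hc Gx m0) => v.
by have := Hm v; rewrite bform_opp; lra.
Qed.

Theorem gaussian_sum_maxima_count : morse h -> exists N M : nat,
  [/\ critical_points h #= `I_N, local_maxima h #= `I_M &
      (M <= (N + 1) %/ 2)%N].
Proof.
move=> hmorse; have /finite_seqP[s0 s0E] := gaussian_sum_critical_finite hmorse.
pose s := undup s0; have us : uniq s by exact: undup_uniq.
have critE x : x \in s <-> critical_points h x.
  by rewrite s0E /s mem_undup.
pose is_max x := `[< local_max h x >].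
pose P := seq.filter is_max s; pose S := seq.filter (predC is_max) s.
have maxcrit x : local_max h x -> critical_points h x.
  move=> xmax; apply/critP => v.
  exact: (local_max_critical Gc
    Dh GN v xmax).
have PE x : x \in P <-> local_max h x.
  rewrite mem_filter; split => [/andP[/asboolP]//|xmax].
  by apply/andP; split; [exact/asboolP | apply/critE; exact: maxcrit].
exists (size s), (size P); split.
- rewrite (_ : critical_points h = [set` s]); first exact: card_set_seq.
  by rewrite predeqE => x; split => /critE.
- rewrite (_ : local_maxima h = [set` P]).
    by apply: card_set_seq; exact: filter_uniq.
  by rewrite predeqE => x; rewrite local_maximaP /= PE.
have szs : (size P + size S = size s)%N by rewrite !size_filter count_predC.
suff : (size P <= (size S).+1)%N.
  by rewrite leq_divRL// -szs muln2 -addnn addn1 -addnS leq_add2l.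
have HN v x : bform (gaussian_sum_hess c mu B x) (- v) (- v) =
    bform (gaussian_sum_hess c mu B x) v v.
  by rewrite bformNl bformNr opprK.
apply: (size_maxima_le_saddles hc gaussian_sum_gt0
  gaussian_sum_superlevel_compact
  (filter_uniq _ us) (filter_uniq _ us) PE) => x.
- rewrite mem_filter => /andP[/asboolPn nmax /critE xcrit].
  have [e He] := saddle_convex_direction xcrit (hmorse _ xcrit) nmax.
  exact: (two_sided_convex hc Dh
    DG GN HN
    Hc ((critP x).1 xcrit e) He).
- move=> xP xS; have ncrit : ~ critical_points h x.
    move=> /critE xs; move: xP xS; rewrite !mem_filter xs !andbT /=.
    by case: (is_max x).
  have [e Ge] : exists e, 0 < G e x.
    apply: contrapT => noe; apply: ncrit; apply/critP => v.
    have G_le0 w : G w x <= 0.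
      by rewrite leNgt; apply/negP => Gw; apply: noe; exists w.
    by apply/eqP; rewrite eq_le G_le0 -oppr_le0 -dirgradN G_le0.
  exact: (two_sided_regular hc Gc
    Dh Ge).
Qed.

End PositiveGaussianSum.

Theorem proposition3p4 (R : realType) (d : nat) (h : 'rV[R]_d -> R) :
  (1 <= d)%N ->
  gaussian_mixture h ->
  morse h ->
  exists N M : nat,
    [/\ critical_points h #= `I_N,
        local_maxima h #= `I_M
      & (M <= (N + 1) %/ 2)%N].
Proof.
move=> _ [k [alpha [mu [Sigma [k1 a0 _ pS hE]]]]].
pose c i := alpha i *
  ((2 * pi) `^ (- (d%:R / 2)) * (\det (Sigma i)) `^ (- (1 / 2))).
have c0 i : 0 < c i.
  rewrite !mulr_gt0//; first by rewrite powR_gt0// mulr_gt0// pi_gt0.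
  have : \det (Sigma i) != 0 by rewrite -unitfE -unitmxE; exact: posdef_unitmx.
  by rewrite /powR => /negbTE ->; exact: expR_gt0.
have -> : h = gaussian_sum c mu (fun i => invmx (Sigma i)).
  apply/funext => x; rewrite hE; apply: eq_bigr => i _.
  by rewrite /gaussian_term /c /gaussian_pdf !mulrA.
by apply: gaussian_sum_maxima_count => // i; exact: posdef_invmx.
Qed.
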